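(* Let $\eta,\beta\in\Delta^+$. Then the join $\eta\vee\beta$ of $\eta$ and $\beta$ in $(\Delta^+,\preccurlyeq)$ exists, and it is given as follows. $1^\circ$. If $\mathrm{supp}(\eta)\cup\mathrm{supp}(\beta)$ is a connected subset of the Dynkin diagram of $\Delta$, then $\eta\vee\beta=\max\{\eta,\beta\}$. $2^\circ$. If $\mathrm{supp}(\eta)$ and $\mathrm{supp}(\beta)$ are disjoint (in the sense that $\mathrm{supp}(\eta)\cup\mathrm{supp}(\beta)$ is disconnected), then $\eta\vee\beta=\eta+\beta+(\text{connecting root})$.
   Context: $\Delta$ is a reduced irreducible root system with set of simple roots $\Pi=\{\alpha_1,\dots,\alpha_n\}$ and positive roots $\Delta^+$. Root order on $\Delta^+$: $\mu\preccurlyeq\nu$ iff $\nu-\mu$ is a non-negative integral combination of simple roots. Join: a root $\kappa\in\Delta^+$ is the least upper bound (join) of $\eta,\beta\in\Delta^+$, written $\kappa=\eta\vee\beta$, if $\kappa\succcurlyeq\eta$, $\kappa\succcurlyeq\beta$, and every $\kappa'\in\Delta^+$ with $\kappa'\succcurlyeq\eta$ and $\kappa'\succcurlyeq\beta$ satisfies $\kappa'\succcurlyeq\kappa$. For $\eta=\sum_ia_i\alpha_i$ and $\beta=\sum_ib_i\alpha_i$: $\mathrm{supp}(\eta)=\{\alpha_i\mid a_i\ne0\}$, regarded as a subset of the nodes of the Dynkin diagram (it is connected for every root), and $\max\{\eta,\beta\}=\sum_i\max\{a_i,b_i\}\alpha_i$, a priori only an element of the root lattice. The supports of $\eta,\beta$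 are called disjoint if $\mathrm{supp}(\eta)\cup\mathrm{supp}(\beta)$ is disconnected in the Dynkin diagram. In this case, since the Dynkin diagram is a tree, there is a unique chain of simple roots $\alpha_{i_1},\dots,\alpha_{i_s}$ (lying outside both supports) connecting the two supports; the connecting root is $\alpha_{i_1}+\dots+\alpha_{i_s}$ (which is indeed a root). *)

(* Defs.v *)
From HB Require Import structures.
From mathcomp Require Import all_boot all_order all_algebra.
Set Implicit Arguments.
Unset Strict Implicit.
Unset Printing Implicit Defensive.
Import Order.TTheory GRing.Theory Num.Theory.
Local Open Scope ring_scope.

(* The ambient Euclidean space is a finite-dimensional V over an ordered field  *)
(* R (in particular the reals) with a positive definite symmetric bilinear form *)
(* ip. A finite set of roots is given by a sequence Phi; its order and possible *)
(* repetitions play no role.                                                    *)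

Section RootSystems.
Variables (R : realFieldType) (V : vectType R) (ip : {dot V for idfun}).

Definition cartan (b a : V) : R := 2%:R * ip b a / ip a a.

Definition reflection (a b : V) : V := b - cartan b a *: a.

Record reduced_root_system (Phi : seq V) : Prop := {
  roots_span : <<Phi>>%VS = fullv;
  root_neq0 : 0 \notin Phi;
  root_reflection : {in Phi &, forall a b, reflection a b \in Phi};
  root_integral :
    {in Phi &, forall a b, exists m : int, cartan b a = m%:~R};
  root_reduced :
    {in Phi, forall a (k : R), k *: a \in Phi -> k = 1 \/ k = -1}
}.

Definition irreducible_roots (Phi : seq V) : Prop :=
  Phi <> [::] /\
  forall Phi1 Phi2 : seq V, Phi =i Phi1 ++ Phi2 ->
    (forall a b, a \in Phi1 -> b \in Phi2 -> ip a b = 0) ->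
    Phi1 = [::] \/ Phi2 = [::].

Definition nonneg_comb (n : nat) (Pi : n.-tuple V) (v : V) : Prop :=
  exists c : 'I_n -> nat, v = \sum_(i < n) Pi`_i *+ c i.

Record simple_roots (Phi : seq V) (n : nat) (Pi : n.-tuple V) : Prop := {
  simple_basis : basis_of fullv Pi;
  simple_root : {subset Pi <= Phi};
  simple_sign :
    {in Phi, forall b, nonneg_comb Pi b \/ nonneg_comb Pi (- b)}
}.

Definition positive_root (Phi : seq V) (n : nat) (Pi : n.-tuple V) (v : V) :
  Prop := v \in Phi /\ nonneg_comb Pi v.

Definition root_le (n : nat) (Pi : n.-tuple V) (mu nu : V) : Prop :=
  nonneg_comb Pi (nu - mu).

Definition is_join (Phi : seq V) (n : nat) (Pi : n.-tuple V)
    (eta beta kappa : V) : Prop :=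
  [/\ positive_root Phi Pi kappa,
      root_le Pi eta kappa,
      root_le Pi beta kappa
    & forall kappa', positive_root Phi Pi kappa' ->
        root_le Pi eta kappa' -> root_le Pi beta kappa' ->
        root_le Pi kappa kappa'].

(* coord Pi i v is the coefficient of alpha_i = Pi`_i in v, as Pi is a basis;   *)
(* a subset of Pi is represented by the set of its indices.                     *)
Definition supp (n : nat) (Pi : n.-tuple V) (v : V) : {set 'I_n} :=
  [set i : 'I_n | coord Pi i v != 0].

Definition coord_max (n : nat) (Pi : n.-tuple V) (eta beta : V) : V :=
  \sum_(i < n) Num.max (coord Pi i eta) (coord Pi i beta) *: Pi`_i.

(* Adjacency in the Dynkin diagram; edge multiplicities and arrows are          *)
(* irrelevant to connectedness and chains.                                      *)
Definition dynkin (n : nat) (Pi : n.-tuple V) : rel 'I_n :=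
  [rel i j : 'I_n | (i != j) && (ip Pi`_i Pi`_j != 0)].

End RootSystems.

Section Chains.
Variables (T : finType) (e : rel T).

Definition connected_subset (A : {set T}) : bool :=
  [forall x in A, forall y in A,
     connect [rel u v | [&& u \in A, v \in A & e u v]] x y].

(* s is a nonempty simple path outside A and B whose first node is adjacent to  *)
(* A and whose last node is adjacent to B.                                      *)
Definition connecting_chain (A B : {set T}) (s : seq T) : Prop :=
  if s is x :: p then
    [/\ uniq (x :: p), path e x p,
        {in x :: p, forall z, z \notin A :|: B},
        exists2 a, a \in A & e a x
      & exists2 b, b \in B & e (last x p) b]
  else False.

End Chains.

(* Main.v *)
Require Import Defs.
From HB Require Import structures.
From mathcomp Require Import all_boot all_order all_algebra.
From mathcomp Require Import zify lra.
Set Implicit Arguments.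
Unset Strict Implicit.
Unset Printing Implicit Defensive.
Import Order.TTheory GRing.Theory Num.Theory.
Local Open Scope ring_scope.

(** The whole theorem follows from one elementary fact about roots: if
    [0 < ip a b] then [a - b] is a root or zero (root_sub).  Below, a vector
    with natural coefficients on the simple roots is written [comb f].

    Joins of roots with intersecting supports.  For distinct simple roots
    [x, y], if [v], [v + x] and [v + y] are roots then so is [v + x + y]
    (root_diamond): the difference [x - y] is not a root, having coefficients of both signs, so
    [ip (v + x) (v + y) <= 0], and this forces one of the two upper edges of
    the square.  Moreover one climbs from a root to any larger root by adding
    simple roots one at a time (exists_root_cover).  Starting from a common
    lower bound [a] of [b] and [c], two such climbs span a grid which the
    squares fill in, and its far corner is [max b c]; hence [max b c] is a root
    (maxn_root).  If the supports share a node, the corresponding simple root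
    is such a lower bound.  Once the maximum is a root it is trivially the
    join.

    Joins of roots with disjoint supports.  Then [ip] is nonpositive, and it is
    negative exactly when an edge links the supports, in which case the sum is
    a root, and it is the maximum (join_connected).  When no edge links them,
    adding the nodes of a connecting chain to [eta] one by one, and then
    [beta], remains among the roots (root_path, linked_rootD).  Any root above
    [eta] and [beta] has connected support (root_connected), so its support
    contains some connecting chain; since there is only one, it lies above
    [eta + beta + chain] (join_disconnected).

    Uniqueness of the chain.  Add up the members of a cycle of at least three
    positive roots with pairwise nonpositive products.  Each of them has two
    neighbours in the cycle, and by integrality each neighbour contributes at
    most minus half of its square norm, so the sum has nonpositive square norm
    although it is nonzero (no_obtuse_cycle).  This is applied to the graph whose
    vertices are [eta], [beta] and the simple roots outside both supports: each
    support is thus contracted to one vertex, and connecting chains become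
    simple paths from [eta] to [beta] (connecting_chain_inj). *)

(** * Paths and connected subsets of a graph *)

Section Graphs.

(** Two simple paths with the same ends that first diverge after [x] must meet
    again; up to the first meeting point they bound a cycle. *)
Lemma acyclic_path_unique (T : eqType) (e : rel T) (D : {pred T}) :
    symmetric e ->
    (forall c, uniq c -> (2 < size c)%N -> {subset c <= D} -> ~~ cycle e c) ->
  forall p q x,
    path e x p -> path e x q -> uniq (x :: p) -> uniq (x :: q) ->
    {subset x :: p <= D} -> {subset x :: q <= D} ->
    last x p = last x q -> p = q.
Proof.
move=> e_sym acyclic; elim=> [|a p IHp] [|b q] x //.
- by move=> _ _ _ /= /andP[xNq _] _ _ x_last; rewrite x_last mem_last in xNq.
- by move=> _ _ /= /andP[xNp _] _ _ _ x_last; rewrite -x_last mem_last in xNp.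
have [<-{b}|neq_ab] := eqVneq a b.
  move=> /= /andP[_ ep] /andP[_ eq] /andP[_ up] /andP[_ uq] Dp Dq e_last.
  by congr (_ :: _); apply: (IHp q a) => // z z_in; [apply: Dp|apply: Dq];
    rewrite inE z_in orbT.
move=> ep eq up uq Dp Dq e_last; exfalso.
have hits : has [in b :: q] (a :: p).
  apply/hasP; exists (last a p); first exact: mem_last.
  by move: e_last => /= ->; exact: mem_last.
have {}neq_ab : head x (a :: p) != head x (b :: q) by [].
move: (a :: p) hits ep up Dp neq_ab {e_last IHp} => p'.
(* [y] is the first node of [a :: p] that lies on [b :: q] *)
case/split_find=> y p1 p2 yq.
rewrite -all_predC -cats1 -catA => p1q ep up Dp.
move: (b :: q) yq p1q eq uq Dq => _ /splitPr[q1 q2] p1q eq uq Dq neq_head.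
have cyc : cycle e (x :: p1 ++ y :: rev q1).
  move: ep eq; rewrite /= !cat_path /= rcons_cat cat_path /=.
  case/and3P=> -> -> _ /and3P[eq1 q1y _] /=.
  have := rev_path e x (rcons q1 y).
  rewrite last_rcons belast_rcons rev_cons => ->.
  by rewrite (eq_path (e' := e)) ?rcons_path ?eq1 // => u v; rewrite e_sym.
have ucyc : uniq (x :: p1 ++ y :: rev q1).
  move: up uq p1q; rewrite !cons_uniq !mem_cat !cat_uniq !cons_uniq !inE !negb_or.
  rewrite rev_uniq !mem_rev => /andP[/and3P[-> -> _] /and3P[-> p1y _]].
  case/andP=> /and3P[-> _ _] /and4P[-> q1y _ _] /allP p1q /=.
  move: p1y q1y => /= /andP[-> _] /andP[-> _] /=.
  rewrite andbT; apply/hasPn => z; rewrite mem_rev => zq1.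
  by apply: contraL zq1 => /p1q; rewrite /= mem_cat negb_or => /andP[].
have sz : (2 < size (x :: p1 ++ y :: rev q1))%N.
  move: neq_head; rewrite /= size_cat /= size_rev.
  by case: (p1) (q1) => [|? ?] [|? ?] //=; rewrite ?eqxx // addnS.
suff Dc : {subset x :: p1 ++ y :: rev q1 <= D}.
  by have := acyclic _ ucyc sz Dc; rewrite cyc.
move=> z; rewrite inE mem_cat inE mem_rev.
case/or4P=> [/eqP->|zp|/eqP->|zq].
- by apply: Dp; rewrite inE eqxx.
- by apply: Dp; rewrite inE mem_cat zp orbT.
- by apply: Dp; rewrite inE mem_cat mem_head !orbT.
- by apply: Dq; rewrite inE mem_cat zq orbT.
Qed.

(** The chain runs from the last visit of the path to [A] to the first visit
    to [B] after it; it is nonempty as [A] and [B] are not adjacent. *)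
Lemma connecting_chain_in_path (T : finType) (e : rel T) (A B : {set T}) :
    [disjoint A & B] -> {in A & B, forall a b, ~~ e a b} ->
  forall p a, path e a p -> uniq (a :: p) -> a \in A -> last a p \in B ->
  exists2 s, connecting_chain e A B s & {subset s <= p}.
Proof.
move=> disAB nadj p.
have [m] := ubnP (size p); elim: m p => // m IHm p lt_pm a ep up aA lastB.
have [hitA|missA] := boolP (has [in A] p).
  case/split_find: hitA lt_pm ep up lastB => a' p1 p2 a'A _.
  rewrite size_cat size_rcons cat_path last_cat last_rcons => lt_pm.
  case/andP=> _ ep2 up lastB; have [||//|//|s chain_s sub] := IHm p2 _ a' ep2.
  - by lia.
  - by move: up; rewrite cat_rcons -cat_cons cat_uniq => /and3P[].
  by exists s => // z /sub zp; rewrite mem_cat zp orbT.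
have hitB : has [in B] p.
  case: p lastB {lt_pm missA ep up} => [|x p] lastB.
    by move/pred0P/(_ a): disAB; rewrite /= aA lastB.
  by apply/hasP; exists (last x p); first exact: mem_last.
case/split_find: hitB missA ep up {lt_pm lastB} => b p1 p2 bB.
rewrite -!all_predC cat_path rcons_path all_cat all_rcons => missB.
case/andP=> /andP[_ missA] _ /andP[/andP[ep1 eb] _] up.
exists p1; last by move=> z zp; rewrite mem_cat mem_rcons inE zp orbT.
have {}up : uniq p1.
  by move: up; rewrite cons_uniq cat_uniq rcons_uniq => /and4P[_ /andP[]].
case: p1 missB missA ep1 eb up => [|x p1] missB missA /= ep1 eb up.
  by rewrite (negPf (nadj _ _ aA bB)) in eb.
split.
- exact: up.
- by case/andP: ep1.
- move=> z zp; rewrite inE negb_or.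
  by apply/andP; split; [apply: (allP missA) | apply: (allP missB)].
- by exists a => //; case/andP: ep1.
- by exists b.
Qed.

Lemma connected_set1 (T : finType) (e : rel T) x : connected_subset e [set x].
Proof.
by apply/forall_inP => y /set1P->; apply/forall_inP => z /set1P->; exact: connect0.
Qed.

Lemma connected_setU (T : finType) (e : rel T) (A B : {set T}) :
    symmetric e -> connected_subset e A -> connected_subset e B ->
    (exists2 a, a \in A & exists2 b, b \in B & (a == b) || e a b) ->
  connected_subset e (A :|: B).
Proof.
move=> e_sym connA connB [a aA [b bB eab]].
set r := [rel u v | [&& u \in A :|: B, v \in A :|: B & e u v]].
have r_sym : connect_sym r.
  by apply: sym_connect_sym => u v /=; rewrite e_sym andbCA.
have toA : {in A, forall u, connect r a u}.
  move=> u uA; have /forall_inP/(_ u uA) := forall_inP connA a aA.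
  apply: connect_sub => v w /= /and3P[vA wA evw]; apply: connect1 => /=.
  by rewrite !inE vA wA.
have toB : {in B, forall u, connect r a u}.
  move=> u uB; apply: (@connect_trans _ _ b).
    case/orP: eab => [/eqP->|eab]; first exact: connect0.
    by apply: connect1; rewrite /= !inE aA bB eab orbT.
  have /forall_inP/(_ u uB) := forall_inP connB b bB.
  apply: connect_sub => v w /= /and3P[vB wB evw]; apply: connect1 => /=.
  by rewrite !inE vB wB evw !orbT.
have to u : u \in A :|: B -> connect r a u.
  by rewrite inE => /orP[/toA|/toB].
apply/forall_inP => x /to ax; apply/forall_inP => y /to ay.
by apply: connect_trans ay; rewrite r_sym.
Qed.

Lemma connected_edge_between (T : finType) (e : rel T) (A B : {set T}) a b :
    symmetric e -> connected_subset e (A :|: B) -> [disjoint A & B] ->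
    a \in A -> b \in B ->
  exists2 x, x \in A & exists2 y, y \in B & e x y.
Proof.
move=> e_sym connAB disAB aA bB.
have [/exists_inP[x xA /exists_inP[y yB exy]]|no_edge] :=
  boolP [exists x in A, exists y in B, e x y].
  by exists x => //; exists y.
have offA u : u \in A :|: B -> (u \in A) = (u \notin B).
  rewrite inE; case: (boolP (u \in A)) => [uA _|_ /= ->//].
  by rewrite (disjointFr disAB uA).
set r := [rel u v | [&& u \in A :|: B, v \in A :|: B & e u v]].
have clA : closed r A.
  move=> u v /and3P[uAB vAB euv]; apply/idP/idP => [uA|vA].
    apply/negPn/negP; rewrite offA // negbK => vB; case/negP: no_edge.
    by apply/exists_inP; exists u => //; apply/exists_inP; exists v.
  apply/negPn/negP; rewrite offA // negbK => uB; case/negP: no_edge.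
  by apply/exists_inP; exists v => //; apply/exists_inP; exists u; rewrite // e_sym.
have aAB : a \in A :|: B by rewrite inE aA.
have bAB : b \in A :|: B by rewrite inE bB orbT.
have /forall_inP/(_ b bAB) := forall_inP connAB a aAB.
by move/(closed_connect clA); rewrite aA (disjointFl disAB bB).
Qed.

End Graphs.

(** * Pairs of roots *)

Section Roots.

Variables (R : realFieldType) (V : vectType R) (ip : {dot V for idfun}).
Variables (Phi : seq V) (n : nat) (Pi : n.-tuple V).
Hypothesis rootPhi : reduced_root_system ip Phi.
Hypothesis simplePi : simple_roots Phi Pi.

Lemma ipC u v : ip u v = ip v u.
Proof. by rewrite [LHS]hermitian_subproof expr0 mul1r. Qed.

Lemma ip_gt0 u : (0 < ip u u) = (u != 0).
Proof.
apply/idP/idP => [|/neq0_dnorm_gt0//].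
by apply: contraTneq => ->; rewrite linear0l ltxx.
Qed.

Lemma root_gt0 a : a \in Phi -> 0 < ip a a.
Proof.
by move=> aPhi; rewrite ip_gt0; apply: contraTneq aPhi => ->; exact: root_neq0 rootPhi.
Qed.

Lemma root_opp a : a \in Phi -> - a \in Phi.
Proof.
move=> aPhi; have := root_reflection rootPhi aPhi aPhi.
rewrite /reflection /cartan mulfK ?gt_eqF ?root_gt0 //.
by rewrite scaler_nat mulr2n opprD addNKr.
Qed.

(** The form is over an ordered field in which norms need not have square roots,
    so the integrality of Cartan numbers is used without any angle. *)
Lemma pos_pairing_integral a b : a \in Phi -> b \in Phi -> 0 < ip b a ->
  exists2 m : int, (0 < m) & ip b a *+ 2 = m%:~R * ip a a.
Proof.
move=> aPhi bPhi ba_gt0; have aa := root_gt0 aPhi.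
have [m cm] := root_integral rootPhi aPhi bPhi.
have def_m : ip b a *+ 2 = m%:~R * ip a a.
  by rewrite -cm /cartan divfK ?gt_eqF // mulr_natl.
exists m => //; rewrite -(ltr0z R) -(pmulr_lgt0 _ aa) -def_m.
by rewrite pmulrn_lgt0.
Qed.

(** If one of the two Cartan numbers is 1, a reflection gives [a - b] or its
    opposite.  If both are at least 2, then [ip (a - b) (a - b) <= 0]. *)
Lemma root_sub a b : a \in Phi -> b \in Phi -> 0 < ip a b ->
  a = b \/ a - b \in Phi.
Proof.
move=> aPhi bPhi ab_gt0; have aa := root_gt0 aPhi; have bb := root_gt0 bPhi.
have [m m_gt0 def_m] := pos_pairing_integral bPhi aPhi ab_gt0.
have ba_gt0 : 0 < ip b a by rewrite ipC.
have [k k_gt0 def_k] := pos_pairing_integral aPhi bPhi ba_gt0.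
have [m1|mN1] := eqVneq m 1.
  right; have := root_reflection rootPhi bPhi aPhi.
  rewrite /reflection /cartan mulr_natl def_m m1 mul1r divff ?gt_eqF //.
  by rewrite scale1r.
have [k1|kN1] := eqVneq k 1.
  right; have := root_reflection rootPhi aPhi bPhi.
  rewrite /reflection /cartan mulr_natl def_k k1 mul1r divff ?gt_eqF //.
  by rewrite scale1r => /root_opp; rewrite opprB.
left; apply/eqP; rewrite -subr_eq0; apply/negPn; rewrite -ip_gt0 -leNgt.
have le_bb : 2 * ip b b <= ip a b *+ 2.
  rewrite def_m ler_pM2r // (ler_int R 2); lia.
have le_aa : 2 * ip a a <= ip b a *+ 2.
  rewrite def_k ler_pM2r // (ler_int R 2); lia.
rewrite linearBl !linearBr /=; move: le_aa le_bb; rewrite (ipC b a); lra.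
Qed.

Lemma root_add a b : a \in Phi -> b \in Phi -> ip a b < 0 ->
  a + b = 0 \/ a + b \in Phi.
Proof.
move=> aPhi /root_opp bPhi ab_lt0.
have ab_gt0 : 0 < ip a (- b) by rewrite linearNr /= oppr_gt0.
have [->|] := root_sub aPhi bPhi ab_gt0; first by left; rewrite addNr.
by rewrite opprK; right.
Qed.

(** A nonzero Cartan number of obtuse roots is at most -1. *)
Lemma ip_edge_le a b : a \in Phi -> b \in Phi -> ip a b < 0 ->
  ip a b *+ 2 <= - ip a a.
Proof.
move=> aPhi /root_opp bPhi ab_lt0.
have ba_gt0 : 0 < ip (- b) a by rewrite linearNl /= ipC oppr_gt0.
have [m m_gt0 def_m] := pos_pairing_integral aPhi bPhi ba_gt0.
have le_m : ip a a <= m%:~R * ip a a.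
  by rewrite ler_peMl ?(ltW (root_gt0 aPhi)) ?ler1z.
by move: le_m; rewrite -def_m linearNl /= (ipC b a); lra.
Qed.

(** * Natural combinations of simple roots *)

Definition comb (f : 'I_n -> nat) : V := \sum_(i < n) Pi`_i *+ f i.

Definition bump (f : 'I_n -> nat) (i : 'I_n) : 'I_n -> nat :=
  fun j => (f j + (j == i))%N.

Definition fsupp (f : 'I_n -> nat) : {set 'I_n} := [set i | f i != 0%N].

Lemma eq_comb f g : f =1 g -> comb f = comb g.
Proof. by move=> eq_fg; apply: eq_bigr => i _; rewrite eq_fg. Qed.

Lemma combD f g : comb (fun i => f i + g i)%N = comb f + comb g.
Proof. by rewrite -big_split; apply: eq_bigr => i _; rewrite mulrnDr. Qed.

Lemma comb_delta i : comb (fun j => j == i) = Pi`_i.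
Proof. by rewrite /comb (bigD1 i) //= eqxx big1 ?addr0 // => j /negPf->. Qed.

Lemma comb_bump f (i : 'I_n) : comb (bump f i) = comb f + Pi`_i.
Proof. by rewrite combD comb_delta. Qed.

Lemma coord_comb f i : coord Pi i (comb f) = (f i)%:R.
Proof.
rewrite -(@coord_sum_free _ _ _ Pi (fun i => (f i)%:R) i).
  by congr (coord _ _ _); apply: eq_bigr => j _; rewrite scaler_nat.
by case/andP: (simple_basis simplePi).
Qed.

Lemma comb_inj f g : comb f = comb g -> f =1 g.
Proof.
move=> eq_fg i; apply/eqP; rewrite -(eqr_nat R) -!coord_comb.
by rewrite eq_fg.
Qed.

Lemma supp_comb f : supp Pi (comb f) = fsupp f.
Proof. by apply/setP => i; rewrite !inE coord_comb pnatr_eq0. Qed.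

Lemma root_leP f g : root_le Pi (comb f) (comb g) <-> (forall i, f i <= g i)%N.
Proof.
split=> [[c def_c] i|le_fg].
  have : comb g = comb (fun i => f i + c i)%N by rewrite combD -[comb c]def_c addrC subrK.
  by move/comb_inj->; exact: leq_addr.
exists (fun i => g i - f i)%N; rewrite -/(comb _).
apply/eqP; rewrite subr_eq addrC -combD.
by apply/eqP/eq_comb => i; rewrite subnKC.
Qed.

(** A root cannot have coefficients of both signs. *)
Lemma comb_sub_sign f g i j :
  comb f - comb g \in Phi -> (f i < g i)%N -> (f j <= g j)%N.
Proof.
case/(simple_sign simplePi) => [/root_leP le_gf|].
  by rewrite ltnNge le_gf.
by rewrite opprB => /root_leP.
Qed.

Lemma comb_root_pos f : comb f \in Phi -> exists i, (0 < f i)%N.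
Proof.
move=> fPhi; apply/existsP; apply: contraLR fPhi => /existsPn f0.
suff -> : comb f = 0 by exact: root_neq0 rootPhi.
by apply: big1 => i _; move/(_ i): f0; case: (f i).
Qed.

Lemma simple_in_Phi (i : 'I_n) : Pi`_i \in Phi.
Proof. by apply: (simple_root simplePi); rewrite mem_nth // size_tuple. Qed.

Lemma comb_rootD f g : comb f \in Phi -> comb g \in Phi ->
  ip (comb f) (comb g) < 0 -> comb (fun i => f i + g i)%N \in Phi.
Proof.
move=> fPhi gPhi /(root_add fPhi gPhi); rewrite -combD => -[fg0|//].
have [i fi] := comb_root_pos fPhi; exfalso.
have := coord_comb (fun i => f i + g i)%N i; rewrite fg0 linear0.
move/eqP; rewrite eq_sym pnatr_eq0; lia.
Qed.

Lemma bump_root f (i : 'I_n) :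
  comb f \in Phi -> ip (comb f) Pi`_i < 0 -> comb (bump f i) \in Phi.
Proof.
move=> fPhi fi; apply: comb_rootD; rewrite ?comb_delta // simple_in_Phi //.
Qed.

Lemma simple_sub_root (i j : 'I_n) : Pi`_i - Pi`_j \in Phi -> i = j.
Proof.
rewrite -!comb_delta => /(@comb_sub_sign _ _ j i); rewrite !eqxx eq_sym.
by case: (eqVneq i j) => // _ /(_ isT).
Qed.

Lemma simple_inj (i j : 'I_n) : Pi`_i = Pi`_j -> i = j.
Proof.
by rewrite -!comb_delta => /comb_inj/(_ i); rewrite eqxx; case: eqP.
Qed.

Lemma simple_obtuse (i j : 'I_n) : i != j -> ip Pi`_i Pi`_j <= 0.
Proof.
move=> ne_ij; rewrite leNgt; apply/negP => ij_gt0.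
have [/simple_inj|/simple_sub_root] :=
  root_sub (simple_in_Phi i) (simple_in_Phi j) ij_gt0;
  by move/eqP; rewrite (negPf ne_ij).
Qed.

(** * Supports and the Dynkin diagram *)

Lemma ip_comb f g : ip (comb f) (comb g) =
  \sum_(i < n) \sum_(j < n) ip Pi`_i Pi`_j *+ (f i * g j).
Proof.
rewrite linear_sumlz; apply: eq_bigr => i _.
rewrite linear_sumr; apply: eq_bigr => j _.
by rewrite linearMnl /= linearMnr /= mulrnA mulrnAC.
Qed.

Local Notation adj := (dynkin ip Pi).

Lemma adj_sym : symmetric adj.
Proof. by move=> i j; rewrite /dynkin /= (eq_sym i) (ipC Pi`_i). Qed.

Definition linked f g := [exists i in fsupp f, exists j in fsupp g, adj i j].

(** All terms of the product are nonpositive, and an edge between the supports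
    gives a negative one. *)
Lemma ip_disjoint f g : [disjoint fsupp f & fsupp g] ->
  (ip (comb f) (comb g) <= 0) * ((ip (comb f) (comb g) != 0) = linked f g).
Proof.
move=> disfg.
have term_le0 (i j : 'I_n) : ip Pi`_i Pi`_j *+ (f i * g j) <= 0.
  have [fi|fi] := boolP (i \in fsupp f); last first.
    by move: fi; rewrite inE negbK => /eqP->; rewrite mul0n.
  have [gj|gj] := boolP (j \in fsupp g); last first.
    by move: gj; rewrite inE negbK => /eqP->; rewrite muln0.
  apply: mulrn_wle0; apply: simple_obtuse; apply: contraTneq gj => <-.
  by rewrite (disjointFr disfg fi).
have row_le0 (i : 'I_n) : \sum_(j < n) ip Pi`_i Pi`_j *+ (f i * g j) <= 0.
  by apply: sumr_le0 => j _.
rewrite ip_comb; split; first by apply: sumr_le0 => i _.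
apply/idP/idP => [nz|/exists_inP[i fi /exists_inP[j gj /andP[ne_ij nz_ij]]]].
  apply: contraNT nz => /exists_inPn no_link; apply/eqP.
  apply: big1 => i _; apply: big1 => j _.
  have [fi|fi] := boolP (i \in fsupp f); last first.
    by move: fi; rewrite inE negbK => /eqP->; rewrite mul0n.
  have [gj|gj] := boolP (j \in fsupp g); last first.
    by move: gj; rewrite inE negbK => /eqP->; rewrite muln0.
  have /exists_inPn/(_ j gj) := no_link i fi.
  rewrite /= negb_and !negbK => /orP[/eqP eq_ij|/eqP->]; last by rewrite mul0rn.
  by rewrite eq_ij (disjointFl disfg gj) in fi.
rewrite lt_eqF // (bigD1 i) //= -[ltRHS]addr0 ltr_leD //; last first.
  by apply: sumr_le0.
rewrite (bigD1 j) //= -[ltRHS]addr0 ltr_leD //; last by apply: sumr_le0.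
rewrite pmulrn_llt0 ?lt_neqAle ?nz_ij ?simple_obtuse //.
by move: fi gj; rewrite !inE muln_gt0 !lt0n => -> ->.
Qed.

Lemma fsupp_delta (i : 'I_n) : fsupp (fun j => j == i) = [set i].
Proof. by apply/setP => j; rewrite !inE eqb0 negbK. Qed.

Lemma ip_simple_neq0 f (i : 'I_n) : i \notin fsupp f ->
  (ip (comb f) Pi`_i != 0) = [exists a in fsupp f, adj a i].
Proof.
move=> iNf; rewrite -{1}comb_delta (ip_disjoint _).2; last first.
  by rewrite fsupp_delta disjoint_sym disjoints1.
apply: eq_existsb => a; congr (_ && _); rewrite fsupp_delta.
apply/exists_inP/idP => [[j /set1P->]//|ai]; by exists i; rewrite ?set11.
Qed.

Lemma linked_rootD f g : comb f \in Phi -> comb g \in Phi ->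
  [disjoint fsupp f & fsupp g] -> linked f g ->
  comb (fun i => f i + g i)%N \in Phi.
Proof.
move=> fPhi gPhi disfg; rewrite -(ip_disjoint disfg).2 => nz.
by apply: comb_rootD; rewrite // lt_neqAle nz (ip_disjoint disfg).1.
Qed.

(** * Climbing in the root order *)

(** As [d = g - f] has positive norm, some simple root [x] in its support has
    [0 < ip d x]; then [ip f x < 0] and [f + x] is a root, or [0 < ip g x] and
    [g - x] is a root that can replace [g]. *)
Lemma exists_root_cover f g : comb f \in Phi -> comb g \in Phi ->
    (forall i, f i <= g i)%N -> (exists i, f i < g i)%N ->
  exists2 i, (f i < g i)%N & comb (bump f i) \in Phi.
Proof.
move=> fPhi.
have [m] := ubnP (\sum_i (g i - f i)); elim: m g => // m IHm g lt_m gPhi le_fg [k lt_k].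
pose d i := (g i - f i)%N.
have def_g : comb g = comb f + comb d.
  by rewrite -combD; apply: eq_comb => i; rewrite subnKC.
have dd_gt0 : 0 < ip (comb d) (comb d).
  rewrite ip_gt0; apply: contraTneq lt_k => d0.
  have := coord_comb d k; rewrite d0 linear0 => /eqP.
  by rewrite eq_sym pnatr_eq0 subn_eq0 -leqNgt.
have [i di_gt0 ip_di] : exists2 i, (0 < d i)%N & 0 < ip (comb d) Pi`_i.
  have [/exists_inP[i ? ?]|/exists_inPn no_i] :=
    boolP [exists i in [pred i | 0 < d i]%N, 0 < ip (comb d) Pi`_i].
    by exists i.
  move: dd_gt0; rewrite {2}/comb linear_sumr ltNge /= sumr_le0 // => i _.
  rewrite linearMnr /=; have [->//|di_gt0] := posnP (d i).
  by apply: mulrn_wle0; rewrite leNgt; apply: no_i.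
have lt_i : (f i < g i)%N by rewrite -subn_gt0.
have [ip_fi|ip_fi] := ltP (ip (comb f) Pi`_i) 0.
  by exists i => //; apply: bump_root.
have ip_gi : 0 < ip (comb g) Pi`_i by rewrite def_g linearDl /= ltr_wpDl.
pose h j := (g j - (j == i))%N.
have def_h : comb g - Pi`_i = comb h.
  apply/eqP; rewrite subr_eq -comb_bump; apply/eqP/eq_comb => j.
  by rewrite /bump /h; case: eqP => [->|_]; lia.
have hPhi : comb h \in Phi.
  have [g_eq|] := root_sub gPhi (simple_in_Phi i) ip_gi; last by rewrite def_h.
  have [j fj] := comb_root_pos fPhi.
  have := comb_inj (etrans g_eq (esym (comb_delta i))) j.
  move: (le_fg j); case: eqP => [eq_ji|_]; last by lia.
  by move: fj lt_i; rewrite eq_ji; lia.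
have le_fh j : (f j <= h j)%N.
  by rewrite /h; have := le_fg j; case: eqP => [->|]; lia.
have [/existsP ex_lt|/existsPn no_lt] := boolP [exists j, f j < h j]%N.
  have [|j lt_j jPhi] := IHm h _ hPhi le_fh ex_lt; last first.
    by exists j => //; apply: leq_trans lt_j _; rewrite /h leq_subr.
  rewrite ltnS in lt_m; apply: leq_trans lt_m; rewrite (bigD1 i) // [leqRHS](bigD1 i) //=.
  rewrite -addSn leq_add ?leq_sum // => [|j _]; rewrite /h ?leq_sub2r ?leq_subr //.
  by rewrite eqxx; lia.
exists i => //; rewrite (_ : comb _ = comb g) //; apply: eq_comb => j.
have := no_lt j; have := le_fh j; have := le_fg j; rewrite /h /bump.
by case: eqP => [->|_]; lia.
Qed.

(** If [v] is the bottom of the square, [ip (v + x) y] and [ip (v + y) x] cannot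
    both be nonnegative: the first, with [ip (v + x) (v + y) <= 0], gives
    [ip x v < 0], and the second gives [0 <= ip v x] since [ip x y <= 0]. *)
Lemma root_diamond f i j : i != j -> comb f \in Phi ->
    comb (bump f i) \in Phi -> comb (bump f j) \in Phi ->
  comb (bump (bump f i) j) \in Phi.
Proof.
move=> ne_ij fPhi fiPhi fjPhi; have ff := root_gt0 fPhi.
have obt : ip (comb (bump f i)) (comb (bump f j)) <= 0.
  rewrite leNgt; apply/negP => /(root_sub fiPhi fjPhi); rewrite !comb_bump.
  case=> [/addrI/simple_inj|].
    by move/eqP; rewrite (negPf ne_ij).
  rewrite opprD addrACA subrr add0r => /simple_sub_root.
  by move/eqP; rewrite (negPf ne_ij).
have [ip_j|ip_j] := ltP (ip (comb (bump f i)) Pi`_j) 0; first exact: bump_root.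
have [ip_i|ip_i] := ltP (ip (comb (bump f j)) Pi`_i) 0.
  rewrite (_ : comb _ = comb (bump (bump f j) i)); first exact: bump_root.
  by apply: eq_comb => k; rewrite /bump addnAC.
exfalso; move: obt ip_i ip_j (simple_obtuse ne_ij).
rewrite !comb_bump !linearDl !linearDr /= (ipC Pi`_i (comb f)) (ipC Pi`_j Pi`_i).
lra.
Qed.

(** Induction on the total height of [b] and [c] above [a].  Take covers
    [a + x <= b] and [a + y <= c].  If one of them is a common lower bound, use it
    in place of [a].  Otherwise [x] does not occur in [c - a], nor [y] in [b - a]; the
    induction hypothesis for [b] and [a + x + y] over [a + x] shows that [b + y]
    is a root, being their maximum, and its use for [b + y] and [c] over [a + y]
    concludes. *)
Lemma maxn_root a b c :
    comb a \in Phi -> comb b \in Phi -> comb c \in Phi ->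
    (forall i, a i <= b i)%N -> (forall i, a i <= c i)%N ->
  comb (fun i => maxn (b i) (c i)) \in Phi.
Proof.
have [m] := ubnP (\sum_i (b i - a i) + \sum_i (c i - a i)).
elim: m a b c => // m IHm a b c lt_m aPhi bPhi cPhi le_ab le_ac.
have [/existsP lt_ab|/existsPn eq_ab] := boolP [exists i, a i < b i]%N; last first.
  rewrite (_ : comb _ = comb c) //; apply: eq_comb => i.
  by move: (eq_ab i) (le_ac i); lia.
have [/existsP lt_ac|/existsPn eq_ac] := boolP [exists i, a i < c i]%N; last first.
  rewrite (_ : comb _ = comb b) //; apply: eq_comb => i.
  by move: (eq_ac i) (le_ab i); lia.
have [i lt_i iPhi] := exists_root_cover aPhi bPhi le_ab lt_ab.
have [j lt_j jPhi] := exists_root_cover aPhi cPhi le_ac lt_ac.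
have bump_sum (x : 'I_n -> nat) k : (a k < x k)%N ->
    (\sum_l (x l - a l) = (\sum_l (x l - bump a k l)).+1)%N.
  move=> lt_k; rewrite (bigD1 k) //= [in RHS](bigD1 k) //= /bump eqxx.
  rewrite (eq_bigr (fun l => x l - (a l + (l == k)))%N); first lia.
  by move=> l /negPf->; rewrite addn0.
have bump_le (x : 'I_n -> nat) k :
    (forall l, a l <= x l)%N -> (a k < x k)%N -> forall l, (bump a k l <= x l)%N.
  by move=> le_ax lt_k l; rewrite /bump; case: eqP => [->|_]; rewrite ?addn1 ?addn0.
have [lt_ci|le_ci] := ltnP (a i) (c i).
  apply: (IHm (bump a i)) => //; [|exact: bump_le|exact: bump_le].
  by move: lt_m; rewrite (bump_sum b i) // (bump_sum c i) //; lia.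
have [lt_bj|le_bj] := ltnP (a j) (b j).
  apply: (IHm (bump a j)) => //; [|exact: bump_le|exact: bump_le].
  by move: lt_m; rewrite (bump_sum b j) // (bump_sum c j) //; lia.
have ne_ij : i != j by apply: contraTneq lt_i => ->; rewrite -leqNgt.
have ijPhi := root_diamond ne_ij aPhi iPhi jPhi.
have sum_delta : (\sum_l (bump (bump a i) j l - bump a i l) = 1)%N.
  rewrite (bigD1 j) //= big1 => [|l /negPf ne_lj].
    by rewrite {1}/bump eqxx addKn.
  by rewrite {1}/bump ne_lj addn0 subnn.
have bjPhi : comb (bump b j) \in Phi.
  rewrite (_ : comb _ = comb (fun l => maxn (b l) (bump (bump a i) j l))).
    apply: (IHm (bump a i)) => //; [|exact: bump_le|].
      move: lt_m; rewrite (bump_sum b i) // (bump_sum c j) // sum_delta; lia.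
    by move=> l; rewrite leq_addr.
  apply: eq_comb => l; rewrite /bump; have := le_ab l.
  have [->|_] := eqVneq l j; first by rewrite [j == i]eq_sym (negPf ne_ij); lia.
  by have [->|_] := eqVneq l i; lia.
rewrite (_ : comb _ = comb (fun l => maxn (bump b j l) (c l))).
  apply: (IHm (bump a j)) => //; [|move=> l|exact: bump_le].
    move: lt_m; rewrite (bump_sum b i) // (bump_sum c j) //.
    have -> : (\sum_l (bump b j l - bump a j l) = \sum_l (b l - a l))%N.
      by apply: eq_bigr => l _; rewrite subnDr.
    by rewrite (bump_sum b i) //; lia.
  by rewrite leq_add2r.
apply: eq_comb => l; rewrite /bump; have := le_ab l.
by case: (eqVneq l j) => [->|_]; lia.
Qed.

(** * Supports of roots are connected *)

(** If [x] were orthogonal to [f] and outside its support, the reflection in [x]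
    would map the root [f + x] to [f - x], which has coefficients of both
    signs. *)
Lemma bump_connected f (i : 'I_n) : comb f \in Phi -> comb (bump f i) \in Phi ->
  connected_subset adj (fsupp f) -> connected_subset adj (fsupp (bump f i)).
Proof.
move=> fPhi fiPhi conn_f.
have -> : fsupp (bump f i) = fsupp f :|: [set i].
  by apply/setP => j; rewrite !inE /bump addn_eq0 eqb0 negb_and negbK.
apply: connected_setU => //; first exact: adj_sym.
  exact: connected_set1.
have [k fk] := comb_root_pos fPhi.
have kf : k \in fsupp f by rewrite inE -lt0n.
suff [j jf ji] : exists2 j, j \in fsupp f & (j == i) || adj j i.
  by exists j => //; exists i; rewrite ?set11.
have [|iNf] := boolP (i \in fsupp f); first by exists i; rewrite ?eqxx.
have [fi0|nz] := eqVneq (ip (comb f) Pi`_i) 0; last first.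
  move: nz; rewrite ip_simple_neq0 // => /exists_inP[j jf ji].
  by exists j; rewrite ?ji ?orbT.
exfalso; have ii := root_gt0 (simple_in_Phi i).
have := root_reflection rootPhi (simple_in_Phi i) fiPhi.
rewrite /reflection /cartan comb_bump linearDl /= fi0 add0r mulfK ?gt_eqF //.
rewrite scaler_nat mulr2n opprD addrA addrK -comb_delta.
have /negPf ne_ki : k != i by apply: contraNneq iNf => <-.
move/(@comb_sub_sign _ _ i k); rewrite eqxx ne_ki.
move: iNf; rewrite inE negbK => /eqP-> /(_ isT).
by rewrite leqNgt fk.
Qed.

Lemma root_connected f : comb f \in Phi -> connected_subset adj (fsupp f).
Proof.
move=> fPhi; have [k fk] := comb_root_pos fPhi.
suff up g : comb g \in Phi -> (forall i, g i <= f i)%N ->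
    connected_subset adj (fsupp g) -> connected_subset adj (fsupp f).
  apply: (up (fun j => j == k)); rewrite ?comb_delta ?simple_in_Phi //.
    by move=> i; case: eqP => // ->.
  rewrite fsupp_delta; exact: connected_set1.
have [m] := ubnP (\sum_i (f i - g i)); elim: m g => // m IHm g lt_m gPhi le_gf conn_g.
have [/existsP lt_gf|/existsPn eq_gf] := boolP [exists i, g i < f i]%N; last first.
  suff <- : fsupp g = fsupp f by [].
  apply/setP => i; rewrite !inE; congr (_ != _).
  by move: (eq_gf i) (le_gf i); lia.
have [i lt_i iPhi] := exists_root_cover gPhi fPhi le_gf lt_gf.
apply: (IHm (bump g i)) => //; last exact: bump_connected.
  rewrite ltnS in lt_m; apply: leq_trans lt_m; rewrite (bigD1 i) // [leqRHS](bigD1 i) //=.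
  rewrite -addSn leq_add ?leq_sum // => [|j _]; rewrite /bump ?eqxx; last first.
    by rewrite leq_sub2l // leq_addr.
  by move: lt_i; lia.
by move=> j; rewrite /bump; case: eqP => [->|_]; rewrite ?addn1 ?addn0.
Qed.

(** Each node of the path has a negative product with the sum of [f] and the
    earlier nodes, as it is linked to the support of that sum but outside it. *)
Lemma root_path f a s : comb f \in Phi -> a \in fsupp f -> path adj a s ->
    uniq s -> {in s, forall z, z \notin fsupp f} ->
  comb (fun j => f j + (j \in s))%N \in Phi.
Proof.
elim: s f a => [|x s IHs] f a fPhi af /=.
  by move=> _ _ _; rewrite (_ : comb _ = comb f) //; apply: eq_comb => j; rewrite addn0.
case/andP=> ax xs /andP[xNs us] sNf.
have xNf : x \notin fsupp f by apply: sNf; rewrite mem_head.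
have xPhi : comb (bump f x) \in Phi.
  apply: linked_rootD; rewrite ?comb_delta ?simple_in_Phi ?fsupp_delta //.
    by rewrite disjoint_sym disjoints1.
  apply/exists_inP; exists a => //; apply/exists_inP; exists x => //.
  by rewrite fsupp_delta set11.
rewrite (_ : comb _ = comb (fun j => bump f x j + (j \in s))%N).
  apply: (IHs (bump f x) x) => //; first by rewrite inE /bump eqxx addn1.
  move=> z zs; rewrite inE /bump; have /sNf : z \in x :: s by rewrite inE zs orbT.
  rewrite inE negbK => /eqP->; rewrite (_ : z == x = false) //.
  by apply: contraNF xNs => /eqP<-.
apply: eq_comb => j; rewrite /bump inE -addnA; congr (_ + _)%N.
by case: eqP => // ->; rewrite (negPf xNs).
Qed.

(** * Uniqueness of the connecting chain *)

Lemma sum_positive_neq0 (c : seq V) v :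
  v \in c -> {in c, forall u, positive_root Phi Pi u} -> \sum_(u <- c) u != 0.
Proof.
move=> vc pos; have [vPhi [h def_v]] := pos v vc.
have [i hi] : exists i, (0 < h i)%N by apply: comb_root_pos; rewrite /comb -def_v.
apply/eqP => c0; have := congr1 (coord Pi i) c0.
rewrite linear_sum linear0 /= (big_rem v) //= => /eqP.
rewrite gt_eqF // ltr_wpDr //.
  rewrite big_seq; apply: sumr_ge0 => u /mem_rem/pos[_ [g ->]].
  by rewrite -/(comb g) coord_comb ler0n.
by rewrite def_v -/(comb h) coord_comb ltr0n.
Qed.

(** With [S] the sum over the cycle, every [u] in it satisfies [ip u S <= 0]: its
    own norm is cancelled by the two neighbours.  Hence [ip S S <= 0]. *)
Lemma no_obtuse_cycle (c : seq V) :
    {in c, forall u, positive_root Phi Pi u} ->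
    {in c &, forall u v, u != v -> ip u v <= 0} ->
    uniq c -> (2 < size c)%N -> ~~ cycle [rel u v | ip u v != 0] c.
Proof.
move=> pos obt uc sz; apply/negP => cyc.
have row_le0 u : u \in c -> ip u (\sum_(v <- c) v) <= 0.
  (* rotate the cycle to [u, v, ..., w], so that [v] and [w] are the neighbours *)
  move=> uc'; have [i c' def_c] := rot_to uc'.
  have perm_c : perm_eq c (u :: c') by rewrite -def_c perm_sym perm_rot.
  rewrite (perm_big _ perm_c) /=.
  have sz' : (2 < size (u :: c'))%N by rewrite -def_c size_rot.
  have uniq' : uniq (u :: c') by rewrite -def_c rot_uniq.
  have cyc' : cycle [rel u v | ip u v != 0] (u :: c') by rewrite -def_c rot_cycle.
  have mem' : u :: c' =i c by move=> z; rewrite -def_c mem_rot.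
  case: c' {def_c perm_c} => [//|v c'] in sz' uniq' cyc' mem' *.
  case/lastP: c' => [//|c' w] in sz' uniq' cyc' mem' *.
  have [uPhi _] := pos u uc'.
  have nbr z : z \in v :: rcons c' w -> z \in c /\ u != z.
    move=> zc; split; first by rewrite -mem' inE zc orbT.
    by apply: contraTneq zc => <-; case/andP: uniq'.
  have edge z : z \in v :: rcons c' w -> ip u z != 0 -> ip u z *+ 2 <= - ip u u.
    move=> /nbr[zc ne_uz] nz; apply: ip_edge_le => //; first by case: (pos z zc).
    by rewrite lt_neqAle nz obt.
  have uv : ip u v *+ 2 <= - ip u u.
    by apply: edge; rewrite ?mem_head //; case/andP: cyc'.
  have uw : ip u w *+ 2 <= - ip u u.
    apply: edge; first by rewrite inE mem_rcons mem_head orbT.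
    by move: cyc' => /= /andP[_]; rewrite rcons_path last_rcons ipC /= => /andP[].
  rewrite !big_cons big_rcons /= !linearDr /= linear_sumr /=.
  have : \sum_(z <- c') ip u z <= 0.
    rewrite big_seq; apply: sumr_le0 => z zc'.
    have /nbr[zc ne_uz] : z \in v :: rcons c' w.
      by rewrite inE mem_rcons inE zc' !orbT.
    exact: obt.
  by move: uv uw; lra.
have [v vc] : exists v, v \in c.
  by case: (c) sz => // v c' _; exists v; rewrite mem_head.
have := sum_positive_neq0 vc pos; rewrite -ip_gt0 ltNge => /negP; apply.
by rewrite linear_sumlz big_seq; apply: sumr_le0 => u /row_le0.
Qed.

(** The contraction of both supports turns a connecting chain into a simple path
    from [comb f] to [comb g]. *)
Lemma chain_path f g s : comb f \in Phi -> comb g \in Phi ->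
    [disjoint fsupp f & fsupp g] -> connecting_chain adj (fsupp f) (fsupp g) s ->
  [/\ path [rel u v | ip u v != 0] (comb f)
         (rcons [seq Pi`_(i : 'I_n) | i <- s] (comb g)),
      uniq (comb f :: rcons [seq Pi`_(i : 'I_n) | i <- s] (comb g))
    & {subset comb f :: rcons [seq Pi`_(i : 'I_n) | i <- s] (comb g) <=
       comb f :: comb g ::
         [seq Pi`_(i : 'I_n) | i <- enum (~: (fsupp f :|: fsupp g))]}].
Proof.
move=> fPhi gPhi disfg; case: s => // x p [us xp sN [a af ax] [b bg pb]].
have sNf z : z \in x :: p -> z \notin fsupp f.
  by move/sN; rewrite inE negb_or => /andP[].
have sNg z : z \in x :: p -> z \notin fsupp g.
  by move/sN; rewrite inE negb_or => /andP[].
have notin_s h : (forall z, z \in x :: p -> z \notin fsupp h) ->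
    comb h \notin [seq Pi`_(i : 'I_n) | i <- x :: p].
  move=> sNh; apply/negP => /mapP[z zs].
  rewrite -comb_delta => /comb_inj/(_ z); rewrite eqxx => hz.
  by have := sNh z zs; rewrite inE hz.
split.
- rewrite rcons_path /= (last_map (fun i : 'I_n => Pi`_i)).
  rewrite ip_simple_neq0 ?sNf ?mem_head //.
  rewrite ipC ip_simple_neq0 ?sNg ?mem_last //.
  rewrite (@path_map _ _ (fun i : 'I_n => Pi`_i)).
  apply/andP; split; last by apply/exists_inP; exists b; rewrite // adj_sym.
  apply/andP; split; first by apply/exists_inP; exists a.
  by apply: sub_path xp => i j /andP[].
- rewrite cons_uniq rcons_uniq mem_rcons inE negb_or notin_s // notin_s //.
  rewrite (map_inj_uniq simple_inj) us !andbT.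
  apply/eqP => /comb_inj eq_fg.
  by have := disjointFr disfg af; rewrite inE -eq_fg; move: af; rewrite inE => ->.
- move=> v; rewrite in_cons mem_rcons in_cons.
  case/or3P=> [/eqP->|/eqP->|/mapP[z zs ->]]; rewrite !inE ?eqxx ?orbT //.
  apply/orP; right; apply/orP; right.
  by apply: (map_f (fun i : 'I_n => Pi`_i)); rewrite mem_enum inE sN.
Qed.

Lemma connecting_chain_inj f g s t : comb f \in Phi -> comb g \in Phi ->
    [disjoint fsupp f & fsupp g] ->
    connecting_chain adj (fsupp f) (fsupp g) s ->
    connecting_chain adj (fsupp f) (fsupp g) t -> s = t.
Proof.
move=> fPhi gPhi disfg.
move=> /(chain_path fPhi gPhi disfg)[es us Ws] /(chain_path fPhi gPhi disfg)[et ut Wt].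
suff : rcons [seq Pi`_(i : 'I_n) | i <- s] (comb g) =
       rcons [seq Pi`_(i : 'I_n) | i <- t] (comb g).
  by move=> eq_st; apply: (inj_map simple_inj); apply: rcons_injl eq_st.
set W := _ :: _ :: _ in Ws Wt.
apply: (acyclic_path_unique _ _ es et us ut Ws Wt); last by rewrite !last_rcons.
  by move=> u v /=; rewrite ipC.
(* [owner i] is the vertex to which node [i] is contracted *)
pose owner i := if i \in fsupp f then comb f else
                if i \in fsupp g then comb g else Pi`_i.
have W_comb v : v \in W -> exists2 h, v = comb h &
    comb h \in Phi /\ {in fsupp h, forall i, owner i = v}.
  rewrite !inE => /or3P[/eqP->|/eqP->|/mapP[z]].
  - by exists f; split=> // i fi; rewrite /owner fi.
  - by exists g; split=> // i gi; rewrite /owner (disjointFl disfg gi) gi.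
  - rewrite mem_enum !inE negb_or -comb_delta => /andP[zf zg] ->.
    exists (fun j => j == z) => //; rewrite comb_delta simple_in_Phi.
    split=> // i; rewrite fsupp_delta => /set1P->.
    by rewrite /owner !inE (negPf zf) (negPf zg).
move=> c uc sz cW; apply: no_obtuse_cycle => // [u /cW/W_comb[h -> [hPhi _]]|u v].
  by split=> //; exists h.
move=> /cW/W_comb[h -> [_ own_h]] /cW/W_comb[k -> [_ own_k]] ne_hk.
apply: (ip_disjoint _).1; rewrite -setI_eq0; apply/set0Pn => -[i /setIP[ih ik]].
by rewrite -(own_h i ih) (own_k i ik) eqxx in ne_hk.
Qed.

(** * Connectedness of the Dynkin diagram *)

Lemma root_signP v : v \in Phi -> exists f,
  [/\ comb f \in Phi, supp Pi v = fsupp f & v = comb f \/ v = - comb f].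
Proof.
move=> vPhi; have [[f def_v]|[f def_v]] := simple_sign simplePi vPhi; exists f.
  by rewrite /comb -def_v; split=> //; [rewrite def_v supp_comb | left].
rewrite /comb -def_v opprK root_opp //; split=> //; last by right.
by rewrite -supp_comb /comb -def_v; apply/setP => i; rewrite !inE linearN oppr_eq0.
Qed.

(** Were [j] outside the component [C] of [i], the roots with support inside [C]
    and the other roots would split [Phi] orthogonally, since the support of a
    root, being connected, lies inside or outside [C]. *)
Lemma dynkin_connect : irreducible_roots ip Phi -> forall i j, connect adj i j.
Proof.
move=> [_ irr] i j; apply: contraT => ij.
pose C := [set k | connect adj i k].
have [] := irr [seq v <- Phi | supp Pi v \subset C]
               [seq v <- Phi | ~~ (supp Pi v \subset C)].
- by move=> v; rewrite mem_cat !mem_filter; case: (supp Pi v \subset C); rewrite ?orbF.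
- move=> a b; rewrite !mem_filter => /andP[aC aPhi] /andP[bC bPhi].
  have [f [fPhi sf def_a]] := root_signP aPhi.
  have [g [gPhi sg def_b]] := root_signP bPhi.
  rewrite {}sf in aC; rewrite {}sg in bC.
  have offC l : l \in fsupp g -> l \notin C.
    move=> lg; apply: contra bC => lC; apply/subsetP => k kg.
    have /forall_inP/(_ k kg) := forall_inP (root_connected gPhi) l lg.
    rewrite inE in lC; rewrite inE => lk; apply: connect_trans lC _.
    by apply: connect_sub lk => u v /and3P[_ _]; exact: connect1.
  have dis : [disjoint fsupp f & fsupp g].
    rewrite disjoints_subset; apply: subset_trans aC _; apply/subsetP => k kC.
    by rewrite inE; apply: contraL kC; exact: offC.
  have fg0 : ip (comb f) (comb g) = 0.
    apply/eqP; rewrite -[_ == _]negbK (ip_disjoint dis).2.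
    apply/exists_inPn => k kf; apply/exists_inPn => l /offC.
    apply: contra => kl; move/subsetP/(_ k kf): aC; rewrite !inE => ik.
    exact: connect_trans ik (connect1 kl).
  by case: def_a => ->; case: def_b => ->;
    rewrite ?linearNl /= ?linearNr /= fg0 ?oppr0.
- move=> nil1; have : Pi`_i \in [seq v <- Phi | supp Pi v \subset C].
    rewrite mem_filter simple_in_Phi -comb_delta supp_comb fsupp_delta.
    by rewrite sub1set inE connect0.
  by rewrite nil1.
- move=> nil2; have : Pi`_j \in [seq v <- Phi | ~~ (supp Pi v \subset C)].
    rewrite mem_filter simple_in_Phi -comb_delta supp_comb fsupp_delta.
    by rewrite sub1set inE ij.
  by rewrite nil2.
Qed.

(** * Joins *)

Lemma join_combP f g k : comb k \in Phi ->
    (forall i, f i <= k i)%N -> (forall i, g i <= k i)%N ->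
    (forall h, comb h \in Phi -> (forall i, f i <= h i)%N ->
       (forall i, g i <= h i)%N -> forall i, (k i <= h i)%N) ->
  is_join Phi Pi (comb f) (comb g) (comb k).
Proof.
move=> kPhi le_fk le_gk lub; split; [by split=> //; exists k | exact/root_leP..|].
move=> v [vPhi [h def_v]]; rewrite {v}def_v -/(comb h) in vPhi *.
by move=> /root_leP le_fh /root_leP le_gh; apply/root_leP/lub.
Qed.

Lemma coord_max_comb f g :
  coord_max Pi (comb f) (comb g) = comb (fun i => maxn (f i) (g i)).
Proof.
apply: eq_bigr => i _; rewrite !coord_comb -scaler_nat; congr (_ *: _).
by rewrite -natr_max maxEnat.
Qed.

Lemma join_connected f g : comb f \in Phi -> comb g \in Phi ->
    connected_subset adj (fsupp f :|: fsupp g) ->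
  is_join Phi Pi (comb f) (comb g) (coord_max Pi (comb f) (comb g)).
Proof.
move=> fPhi gPhi conn; rewrite coord_max_comb; apply: join_combP; first last.
- by move=> h _ le_fh le_gh i; rewrite geq_max le_fh le_gh.
- by move=> i; apply: leq_maxr.
- by move=> i; apply: leq_maxl.
have [disfg|] := boolP [disjoint fsupp f & fsupp g]; last first.
  rewrite -setI_eq0 => /set0Pn[i]; rewrite !inE => /andP[fi gi].
  apply: (@maxn_root (fun j => j == i)); rewrite ?comb_delta ?simple_in_Phi //.
    by move=> j; case: eqP => // ->; rewrite lt0n.
  by move=> j; case: eqP => // ->; rewrite lt0n.
have [a fa] := comb_root_pos fPhi; have [b gb] := comb_root_pos gPhi.
rewrite (_ : comb _ = comb (fun i => f i + g i)%N).
  apply: linked_rootD => //.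
  have [||x xf [y yg xy]] := connected_edge_between adj_sym conn disfg (a := a) (b := b).
  - by rewrite inE -lt0n.
  - by rewrite inE -lt0n.
  by apply/exists_inP; exists x => //; apply/exists_inP; exists y.
apply: eq_comb => i; have [fi|] := boolP (i \in fsupp f).
  by move: (disjointFr disfg fi); rewrite inE => /negbFE/eqP->; rewrite maxn0 addn0.
by rewrite inE negbK => /eqP->; rewrite max0n.
Qed.

Lemma join_disconnected f g : irreducible_roots ip Phi ->
    comb f \in Phi -> comb g \in Phi ->
    ~~ connected_subset adj (fsupp f :|: fsupp g) ->
  exists2 s, unique (connecting_chain adj (fsupp f) (fsupp g)) s
    & is_join Phi Pi (comb f) (comb g) (comb f + comb g + \sum_(i <- s) Pi`_i).
Proof.
move=> irr fPhi gPhi disc.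
have no_touch a b : a \in fsupp f -> b \in fsupp g -> ~~ ((a == b) || adj a b).
  move=> af bg; apply: contra disc => ab.
  apply: connected_setU; [exact: adj_sym|exact: root_connected..|].
  by exists a => //; exists b.
have disfg : [disjoint fsupp f & fsupp g].
  rewrite -setI_eq0; apply/set0Pn => -[i /setIP[fi gi]].
  by have := no_touch i i fi gi; rewrite eqxx.
have nadj : {in fsupp f & fsupp g, forall a b, ~~ adj a b}.
  by move=> a b af bg; have := no_touch a b af bg; rewrite negb_or => /andP[].
have [a fa] := comb_root_pos fPhi; have [b gb] := comb_root_pos gPhi.
have {fa} af : a \in fsupp f by rewrite inE -lt0n.
have {gb} bg : b \in fsupp g by rewrite inE -lt0n.
have chain p : path adj a p -> last a p = b ->
    exists2 s, connecting_chain adj (fsupp f) (fsupp g) s & {subset s <= p}.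
  move=> ap pb; case/shortenP: ap pb => q aq uq sub_qp qb.
  have lastg : last a q \in fsupp g by rewrite qb.
  have [s chain_s sub_sq] := connecting_chain_in_path disfg nadj aq uq af lastg.
  by exists s => // z /sub_sq/sub_qp.
have /connectP[p ap /esym/(chain p ap)[s chain_s _]] := dynkin_connect irr a b.
have s_unique t : connecting_chain adj (fsupp f) (fsupp g) t -> s = t.
  exact: connecting_chain_inj chain_s.
exists s; first by split.
have [x [q def_s]] : exists x q, s = x :: q by case: (s) chain_s => // x q; exists x, q.
rewrite def_s in chain_s; case: chain_s => us xq sN [a' a'f a'x] [b' b'g qb'].
rewrite -def_s in us sN.
have sNf z : z \in s -> f z = 0%N.
  by move/sN; rewrite !inE negb_or negbK => /andP[/eqP].
have sNg z : z \in s -> g z = 0%N.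
  by move/sN; rewrite !inE negb_or !negbK => /andP[_ /eqP].
pose k i := (f i + (i \in s))%N.
have kPhi : comb k \in Phi.
  apply: (@root_path f a') => // [|z /sNf fz]; first by rewrite def_s /= a'x.
  by rewrite inE fz.
have sum_s : comb (fun i => i \in s) = \sum_(i <- s) Pi`_i.
  rewrite [RHS]big_uniq //= [RHS]big_mkcond; apply: eq_bigr => i _.
  by case: (i \in s).
have -> : comb f + comb g + \sum_(i <- s) Pi`_i = comb (fun i => k i + g i)%N.
  by rewrite !combD sum_s addrAC.
have fg0 i : f i = 0%N \/ g i = 0%N.
  have [fi|] := boolP (i \in fsupp f); last by rewrite inE negbK => /eqP; left.
  by move: (disjointFr disfg fi); rewrite inE => /negbFE/eqP; right.
apply: join_combP.
- apply: linked_rootD => //.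
    rewrite -setI_eq0; apply/set0Pn => -[i]; rewrite !inE /k.
    have [/sNg->|_] := boolP (i \in s); first by rewrite andbF.
    by rewrite addn0; case: (fg0 i) => ->; rewrite ?andbF.
  apply/exists_inP; exists (last x q); last by apply/exists_inP; exists b'.
  by rewrite inE /k def_s mem_last addn1.
- by move=> i; rewrite /k -addnA leq_addr.
- by move=> i; rewrite leq_addl.
move=> h hPhi le_fh le_gh i.
have fh z : z \in fsupp f -> z \in fsupp h.
  by rewrite !inE -!lt0n => /leq_trans; apply.
have gh z : z \in fsupp g -> z \in fsupp h.
  by rewrite !inE -!lt0n => /leq_trans; apply.
have sub_sh z : z \in s -> (0 < h z)%N.
  have /forall_inP/(_ b (gh b bg)) := forall_inP (root_connected hPhi) a (fh a af).
  case/connectP=> r ar /esym rb.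
  have ar' : path adj a r by apply: sub_path ar => u v /and3P[].
  have [t /s_unique<- sub_sr] := chain r ar' rb.
  move/sub_sr => zr; rewrite lt0n.
  have : all [in fsupp h] r.
    elim: (r) (a) ar {rb ar' sub_sr zr} => //= y r' IH c /andP[/and3P[_ yh _] yr'].
    by rewrite yh; apply: IH yr'.
  by move/allP/(_ z zr); rewrite inE.
rewrite /k; have [zs|_] := boolP (i \in s).
  by rewrite (sNf i) // (sNg i) // sub_sh.
by rewrite addn0; case: (fg0 i) => ->; rewrite ?addn0 ?add0n ?le_fh ?le_gh.
Qed.

End Roots.

Theorem theoremA1 (R : realFieldType) (V : vectType R)
    (ip : {dot V for idfun}) (Phi : seq V) (n : nat) (Pi : n.-tuple V)
    (rootPhi : reduced_root_system ip Phi)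
    (irrPhi : irreducible_roots ip Phi)
    (simplePi : simple_roots Phi Pi)
    (eta beta : V)
    (posEta : positive_root Phi Pi eta)
    (posBeta : positive_root Phi Pi beta) :
  [/\ exists kappa, is_join Phi Pi eta beta kappa,
      connected_subset (dynkin ip Pi) (supp Pi eta :|: supp Pi beta) ->
        is_join Phi Pi eta beta (coord_max Pi eta beta)
    & ~~ connected_subset (dynkin ip Pi) (supp Pi eta :|: supp Pi beta) ->
        exists2 s : seq 'I_n,
          unique (connecting_chain (dynkin ip Pi) (supp Pi eta) (supp Pi beta)) s
          & is_join Phi Pi eta beta (eta + beta + \sum_(i <- s) Pi`_i)].
Proof.
case: posEta posBeta => fPhi [f def_f] [gPhi [g def_g]].
rewrite -/(comb Pi f) in def_f; rewrite -/(comb Pi g) in def_g.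
rewrite {eta}def_f in fPhi *; rewrite {beta}def_g in gPhi *.
rewrite !(supp_comb simplePi).
have conn := join_connected rootPhi simplePi fPhi gPhi.
have disc := join_disconnected rootPhi simplePi irrPhi fPhi gPhi.
split=> //.
have [/conn|/disc[s _]] :=
  boolP (connected_subset (dynkin ip Pi) (fsupp f :|: fsupp g)).
  by exists (coord_max Pi (comb Pi f) (comb Pi g)).
by exists (comb Pi f + comb Pi g + \sum_(i <- s) Pi`_i).
Qed.
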